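(* Let $\mu=\sum_{i=1}^{n}a_{i}\delta_{x_{i}}$ and $\nu=\sum_{j=1}^{m}b_{j}\delta_{y_{j}}$ be discrete probability measures on $\mathbb{R}^{d}$ with $a_{i},b_{j}>0$ and $\sum_{i=1}^{n}a_{i}=\sum_{j=1}^{m}b_{j}=1$, let $\gamma\in\mathscr{P}(\mathbb{R}^{d}\times\mathbb{R}^{d})$ be absolutely continuous with respect to the Lebesgue measure, and let $\lambda>2$. Let $\Psi:\mathbb{R}^{n+m}\to\mathbb{R}^{n+m}$, $\Psi(\alpha,\beta)=(\alpha',\beta')$, be given by $$\alpha_{i}'=\frac1\lambda\log(a_{i})-\frac1\lambda\log\Bigl(\int\phi_{\lambda}(x,\alpha)^{1-\lambda}\psi_{\lambda}(y,\beta)\exp(\lambda\langle x,x_{i}\rangle)\,\tilde\gamma(\mathrm{d}x,\mathrm{d}y)\Bigr),$$ $$\beta_{j}'=\frac1\lambda\log(b_{j})-\frac1\lambda\log\Bigl(\int\phi_{\lambda}(x,\alpha)\psi_{\lambda}(y,\beta)^{1-\lambda}\exp(\lambda\langle y,y_{j}\rangle)\,\tilde\gamma(\mathrm{d}x,\mathrm{d}y)\Bigr).$$ Then there exists $M>0$ such that for any $R\ge M$ the restriction of $\Psi$ to $$B_{R}=\{(\alpha,\beta)\in\mathbb{R}^{n+m}:-R\le\underline{\alpha}+\underline{\beta}\le\overline{\alpha}+\overline{\beta}\le R\}$$ is a contraction under $\|\cdot\|_{l^{\infty}_{\oplus}}$. In particular, there exist $\theta\in(0,1)$ and a fixed point $(\alpha^{\lambda},\beta^{\lambda})$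 of $\Psi$ such that, for any $(\alpha,\beta)\in\mathbb{R}^{n+m}$, $$\|\Psi^{(t)}(\alpha,\beta)-(\alpha^{\lambda},\beta^{\lambda})\|_{l^{\infty}_{\oplus}}=O(\theta^{t})\quad\text{as }t\to\infty,$$ where $\Psi^{(t)}$ is the $t$-th iterate of $\Psi$.
   Context: $\tilde\gamma(\mathrm{d}x,\mathrm{d}y)=\exp(-\tfrac12\|x\|^{2}-\tfrac12\|y\|^{2})\gamma(\mathrm{d}x,\mathrm{d}y)$. For $(\alpha,\beta)\in\mathbb{R}^{n}\times\mathbb{R}^{m}$, $$\phi_{\lambda}(x,\alpha)=\Bigl(\sum_{i=1}^{n}\exp(\lambda\langle x,x_{i}\rangle+\lambda\alpha_{i})\Bigr)^{1/\lambda},\qquad\psi_{\lambda}(y,\beta)=\Bigl(\sum_{j=1}^{m}\exp(\lambda\langle y,y_{j}\rangle+\lambda\beta_{j})\Bigr)^{1/\lambda}.$$ For a vector $v$, $\overline{v}=\max_{i}v_{i}$ and $\underline{v}=\min_{i}v_{i}$. $\|(\alpha,\beta)\|_{l^{\infty}_{\oplus}}=\max_{i,j}|\alpha_{i}+\beta_{j}|$; this is a norm on the quotient $\mathbb{R}^{n+m}_{\oplus}$ of $\mathbb{R}^{n+m}$ by the relation $(\alpha,\beta)\sim_{\oplus}(\alpha+r\mathbf{1},\beta-r\mathbf{1})$, $r\in\mathbb{R}$ ($\mathbf{1}$ the all-ones vector), and a seminorm on $\mathbb{R}^{n+m}$. *)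

(* Defs.v *)
From HB Require Import structures.
From mathcomp Require Import all_boot all_order all_algebra.
From mathcomp Require Import all_classical all_reals all_analysis.
From mathcomp Require Import measurable_realfun.

Set Implicit Arguments.
Unset Strict Implicit.
Unset Printing Implicit Defensive.

Import Order.TTheory GRing.Theory Num.Theory.
Import numFieldNormedType.Exports.

Local Open Scope classical_set_scope.
Local Open Scope ring_scope.

(* R^d is the type d.-tuple R with the sigma-algebra generated by the
   coordinates, i.e. the Borel sigma-algebra; measurableTypeR R is R with its
   Borel sigma-algebra. *)
Notation euclid R d := (d.-tuple (measurableTypeR R)).

Definition euclid_cons (R : realType) (d : nat)
    (z : measurableTypeR R * euclid R d) : euclid R d.+1 :=
  [tuple of z.1 :: z.2].

Lemma measurable_euclid_cons (R : realType) (d : nat) :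
  measurable_fun [set: measurableTypeR R * euclid R d] (@euclid_cons R d).
Proof. exact: measurable_cons. Qed.

Section lebesgue_cons.
Context (R : realType) (d : nat)
  (m : {sigma_finite_measure set (euclid R d) -> \bar R}).

Definition lebesgue_cons (A : set (euclid R d.+1)) : \bar R :=
  (@lebesgue_measure R \x m)%E (@euclid_cons R d @^-1` A).

Let lebesgue_cons0 : lebesgue_cons set0 = 0%E.
Proof. by rewrite /lebesgue_cons preimage_set0 measure0. Qed.

Let lebesgue_cons_ge0 A : (0 <= lebesgue_cons A)%E.
Proof. exact: measure_ge0. Qed.

Let measurable_preimage_cons A : measurable A ->
  measurable (@euclid_cons R d @^-1` A).
Proof.
by move=> mA; rewrite -[X in measurable X]setTI; exact: measurable_euclid_cons.
Qed.

Let lebesgue_cons_sigma_additive : semi_sigma_additive lebesgue_cons.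
Proof.
move=> F mF tF mUF; rewrite /lebesgue_cons preimage_bigcup.
apply: measure_semi_sigma_additive.
- by move=> n; exact: measurable_preimage_cons.
- by apply/trivIsetP => /= i j _ _ ij; rewrite -preimage_setI;
    move/trivIsetP : tF => /(_ _ _ _ _ ij) ->//; rewrite preimage_set0.
- by rewrite -preimage_bigcup; exact: measurable_preimage_cons.
Qed.

HB.instance Definition _ := isMeasure.Build _ _ _ lebesgue_cons
  lebesgue_cons0 lebesgue_cons_ge0 lebesgue_cons_sigma_additive.

Let lebesgue_cons_sigma_finite : sigma_finite setT lebesgue_cons.
Proof.
have /sigma_finiteP[F [FT ndF Foo]] := sigma_finiteT (@lebesgue_measure R).
have /sigma_finiteP[G [GT ndG Goo]] := sigma_finiteT m.
pose uncons (t : euclid R d.+1) : measurableTypeR R * euclid R d :=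
  (thead t, [tuple of behead t]).
have consK : cancel (@euclid_cons R d) uncons.
  by move=> [x t]; congr pair; exact: val_inj.
have muncons : measurable_fun [set: euclid R d.+1] uncons.
  apply: measurable_fun_pair; first exact: measurable_tnth.
  exact: measurable_behead.
exists (fun n => uncons @^-1` (F n `*` G n)).
  rewrite -preimage_bigcup (_ : \bigcup_n _ = setT) ?preimage_setT//.
  apply/seteqP; split=> // -[x y] _.
  have [[n _ Fnx] [k _ Gky]] : (\bigcup_n F n) x /\ (\bigcup_n G n) y.
    by rewrite -FT -GT.
  exists (maxn n k) => //; split => /=.
  - by move: x Fnx; exact/subsetPset/ndF/leq_maxl.
  - by move: y Gky; exact/subsetPset/ndG/leq_maxr.
move=> n; have [mFn Fnoo] := Foo n; have [mGn Gnoo] := Goo n; split.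
  rewrite -[X in measurable X]setTI; apply: muncons => //.
  exact: measurableX.
rewrite /lebesgue_cons (_ : _ @^-1` _ = F n `*` G n); last first.
  by rewrite -comp_preimage (_ : uncons \o _ = id)//; apply/funext.
by rewrite product_measure1E// lte_mul_pinfty// ge0_fin_numE.
Qed.

HB.instance Definition _ := Measure_isSigmaFinite.Build _ _ _ lebesgue_cons
  lebesgue_cons_sigma_finite.

End lebesgue_cons.

Fixpoint lebesgue_euclid (R : realType) (d : nat) :
    {sigma_finite_measure set (euclid R d) -> \bar R} :=
  match d with
  | 0 => \d_([tuple] : euclid R 0)
  | d'.+1 => lebesgue_cons (lebesgue_euclid R d')
  end.

Lemma lebesgue_euclid_box (R : realType) (d : nat)
    (A : 'I_d -> set (measurableTypeR R)) :
  (forall k, measurable (A k)) ->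
  lebesgue_euclid R d [set t | forall k, A k (tnth t k)] =
  (\prod_(k < d) lebesgue_measure (A k))%E.
Proof.
elim: d A => [|d IH] A mA.
  by rewrite big_ord0 /= diracE mem_set// => -[].
rewrite big_ord_recl -IH//= /lebesgue_cons.
rewrite -product_measure1E//; last first.
  rewrite (_ : [set _ | _] =
    \bigcap_(k in [set: 'I_d]) ((@tnth d _)^~ k @^-1` A (lift ord0 k))).
    apply: fin_bigcap_measurable => // k _.
    by rewrite -[X in measurable X]setTI; exact: measurable_tnth.
  by apply/seteqP; split=> t /= h k; [move=> _|]; exact: h.
congr (_ _); apply/seteqP; split=> -[x t] /=.
  by move=> h; split=> [|k]; [exact: (h ord0)|
    have := h (lift ord0 k); rewrite tnthS].
move=> [h0 hS] k; case: (unliftP ord0 k) => [j ->|-> //].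
by rewrite tnthS; exact: hS.
Qed.

Definition dot (R : realType) (d : nat) (x y : euclid R d) : R :=
  \sum_(k < d) tnth x k * tnth y k.

Lemma measurable_sqnorm (R : realType) (d : nat) :
  measurable_fun [set: euclid R d] (fun x => dot x x).
Proof.
by apply: measurable_sum => k; apply: measurable_funM; exact: measurable_tnth.
Qed.

Definition gauss_weight (R : realType) (d : nat)
    (z : euclid R d * euclid R d) : R :=
  expR (- (1 / 2) * dot z.1 z.1 - 1 / 2 * dot z.2 z.2).

Lemma measurable_gauss_weight (R : realType) (d : nat) :
  measurable_fun [set: euclid R d * euclid R d]
    (fun z => gauss_weight z).
Proof.
pose f z := - (1 / 2) * @dot R d z.1 z.1 - 1 / 2 * @dot R d z.2 z.2.
suff mf : measurable_fun [set: euclid R d * euclid R d] f.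
  exact: (measurableT_comp (@measurable_expR R) mf).
apply: measurable_funB.
- apply: measurable_funM => //.
  exact: (measurableT_comp (@measurable_sqnorm R d) measurable_fst).
- apply: measurable_funM => //.
  exact: (measurableT_comp (@measurable_sqnorm R d) measurable_snd).
Qed.

Section gamma_tilde.
Context (R : realType) (d : nat)
  (gamma : probability (euclid R d * euclid R d)%type R).

Definition gamma_tilde (A : set (euclid R d * euclid R d)) : \bar R :=
  (\int[gamma]_(z in A) (gauss_weight z)%:E)%E.

Let gamma_tilde0 : gamma_tilde set0 = 0%E.
Proof. by rewrite /gamma_tilde integral_set0. Qed.

Let gamma_tilde_ge0 A : (0 <= gamma_tilde A)%E.
Proof. by apply: integral_ge0 => z _; rewrite lee_fin expR_ge0. Qed.

Let gamma_tilde_sigma_additive : semi_sigma_additive gamma_tilde.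
Proof.
move=> F mF tF mUF; rewrite /gamma_tilde ge0_integral_bigcup//=.
- apply: is_cvg_ereal_nneg_natsum_cond => n _ _; exact: gamma_tilde_ge0.
- apply/measurable_EFinP; apply: measurable_funTS.
  exact: measurable_gauss_weight.
- by move=> z _; rewrite lee_fin expR_ge0.
Qed.

HB.instance Definition _ := isMeasure.Build _ _ _ gamma_tilde
  gamma_tilde0 gamma_tilde_ge0 gamma_tilde_sigma_additive.

End gamma_tilde.

(* With n points x_i it is phi_lambda(x, alpha); the function psi_lambda is the
   same expression in the points y_j. *)
Definition phi (R : realType) (d n : nat) (lambda : R) (p : 'I_n -> euclid R d)
    (x : euclid R d) (alpha : 'rV[R]_n) : R :=
  (\sum_(i < n) expR (lambda * dot x (p i) + lambda * alpha 0 i)) `^ (1 / lambda).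

Definition Psi (R : realType) (d n m : nat)
    (a : 'I_n -> R) (b : 'I_m -> R)
    (x : 'I_n -> euclid R d) (y : 'I_m -> euclid R d)
    (gamma : probability (euclid R d * euclid R d)%type R) (lambda : R)
    (ab : 'rV[R]_n * 'rV[R]_m) : 'rV[R]_n * 'rV[R]_m :=
  (\row_(i < n) (1 / lambda * ln (a i) - 1 / lambda *
     ln (\int[gamma_tilde gamma]_z
           (phi lambda x z.1 ab.1 `^ (1 - lambda) * phi lambda y z.2 ab.2 *
            expR (lambda * dot z.1 (x i))))),
   \row_(j < m) (1 / lambda * ln (b j) - 1 / lambda *
     ln (\int[gamma_tilde gamma]_z
           (phi lambda x z.1 ab.1 * phi lambda y z.2 ab.2 `^ (1 - lambda) *
            expR (lambda * dot z.2 (y j)))))).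

Definition vmax (R : realType) (n : nat) (v : 'rV[R]_n.+1) : R :=
  \big[Num.max/v 0 ord0]_(i < n.+1) v 0 i.

Definition vmin (R : realType) (n : nat) (v : 'rV[R]_n.+1) : R :=
  \big[Num.min/v 0 ord0]_(i < n.+1) v 0 i.

Definition linf_oplus (R : realType) (n m : nat)
    (ab : 'rV[R]_n.+1 * 'rV[R]_m.+1) : R :=
  \big[Num.max/0]_(i < n.+1) \big[Num.max/0]_(j < m.+1)
    `|ab.1 0 i + ab.2 0 j|.

Definition B_oplus (R : realType) (n m : nat) (r : R) :
    set ('rV[R]_n.+1 * 'rV[R]_m.+1) :=
  [set ab | [&& - r <= vmin ab.1 + vmin ab.2,
                vmin ab.1 + vmin ab.2 <= vmax ab.1 + vmax ab.2
              & vmax ab.1 + vmax ab.2 <= r]].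

(* The library's contraction is stated for the norm of a normedModType; here N
   is only a seminorm. *)
Definition contraction_on (R : realType) (V : zmodType) (N : V -> R)
    (B : set V) (f : V -> V) : Prop :=
  set_fun B B f /\
  exists2 q : R, 0 <= q < 1 &
    forall z w, B z -> B w -> N (f z - f w) <= q * N (z - w).

(* Main.v *)
(* Write [N] for [linf_oplus]; [B_oplus r] is the ball [N <= r].

   Growth.  Up to factors independent of [(alpha, beta)], [phi_lambda] and
   [psi_lambda] are [exp (max alpha)] and [exp (max beta)].  Hence
   [alpha'_i + beta'_j] differs from [(1 - 2 / lambda) (max alpha + max beta)]
   by a bounded amount, so [N (Psi z) <= (1 - 2 / lambda) N z + C]: large balls
   are stable and every orbit ends up in one fixed ball.

   Contraction.  Let [da], [db] be the differences of two points of a ball.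
   Passing from one point to the other multiplies [phi_lambda] by at most
   [exp (max da)], and, since all softmax weights are bounded below on the
   ball, [psi_lambda] by at least [exp (min db + rho (max db - min db))] with
   [rho > 0].  The weights [rho] integrate to a uniform gain, which yields a
   Lipschitz constant [1 - 2 k / lambda] without differentiating [Psi].

   Fixed point.  [Psi z = z] holds at first modulo a shift [(r, - r)]; summing
   the fixed point equations over [i] and over [j] gives
   [exp (- lambda r) = exp (lambda r)], so [r = 0]. *)
Require Import Defs.
From mathcomp Require Import all_boot all_order all_algebra.
From mathcomp Require Import all_classical all_reals all_analysis.
From mathcomp Require Import measurable_realfun.
From mathcomp Require Import ring lra.

Set Implicit Arguments.
Unset Strict Implicit.
Unset Printing Implicit Defensive.

Import Order.TTheory GRing.Theory Num.Theory.
Import numFieldNormedType.Exports.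

Local Open Scope classical_set_scope.
Local Open Scope ring_scope.

(** * Extrema of row vectors *)

Section row_extrema.
Context (R : realType) (n : nat).
Implicit Types v : 'rV[R]_n.+1.

Lemma vmax_ge v i : v 0 i <= vmax v.
Proof. exact: le_bigmax. Qed.

Lemma vmin_le v i : vmin v <= v 0 i.
Proof. exact: bigmin_le. Qed.

Lemma vmax_attained v : exists i, vmax v = v 0 i.
Proof.
rewrite /vmax; apply: (big_ind (fun s => exists i, s = v 0 i)).
- by exists ord0.
- by move=> s t [i ->] [j ->]; case: (leP (v 0 i) (v 0 j)) => _;
    [exists j|exists i].
- by move=> i _; exists i.
Qed.

Lemma vmin_attained v : exists i, vmin v = v 0 i.
Proof.
rewrite /vmin; apply: (big_ind (fun s => exists i, s = v 0 i)).
- by exists ord0.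
- by move=> s t [i ->] [j ->]; case: (leP (v 0 i) (v 0 j)) => _;
    [exists i|exists j].
- by move=> i _; exists i.
Qed.

Lemma vmin_le_vmax v : vmin v <= vmax v.
Proof. by apply: le_trans (vmin_le v ord0) (vmax_ge v ord0). Qed.

End row_extrema.

(** * The seminorm and its balls *)

Section linf_oplus_seminorm.
Context (R : realType) (n m : nat).
Local Notation V := ('rV[R]_n.+1 * 'rV[R]_m.+1)%type.
Local Notation N := (@linf_oplus R n m).
Implicit Types z w : V.

Lemma linf_oplus_ub z i j : `|z.1 0 i + z.2 0 j| <= N z.
Proof.
rewrite /linf_oplus; apply: le_trans
  (le_bigmax 0 (fun i => \big[Num.max/0]_(j < m.+1) `|z.1 0 i + z.2 0 j|) i).
exact: (le_bigmax 0 (fun j => `|z.1 0 i + z.2 0 j|) j).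
Qed.

Lemma linf_oplus_le z r :
  (forall i j, `|z.1 0 i + z.2 0 j| <= r) -> N z <= r.
Proof.
move=> zr; have r0 : 0 <= r by apply: le_trans (zr ord0 ord0).
by apply: bigmax_le => // i _; apply: bigmax_le.
Qed.

Lemma linf_oplus_ge0 z : 0 <= N z.
Proof. by apply: le_trans (linf_oplus_ub z ord0 ord0). Qed.

Lemma linf_oplusN z : N (- z) = N z.
Proof.
suff le w : N (- w) <= N w.
  by apply/eqP; rewrite eq_le le -{1}[z]opprK le.
by apply: linf_oplus_le => i j; rewrite !mxE -opprD normrN linf_oplus_ub.
Qed.

Lemma sum_coordB z w i j : (z - w).1 0 i + (z - w).2 0 j =
  (z.1 0 i + z.2 0 j) - (w.1 0 i + w.2 0 j).
Proof. by rewrite !mxE; ring. Qed.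

Lemma coordB1 z w i : (z - w).1 0 i = z.1 0 i - w.1 0 i.
Proof. by rewrite !mxE. Qed.

Lemma coordB2 z w j : (z - w).2 0 j = z.2 0 j - w.2 0 j.
Proof. by rewrite !mxE. Qed.

Lemma sum_coordBC z w i j :
  - ((z - w).1 0 i + (z - w).2 0 j) = (w - z).1 0 i + (w - z).2 0 j.
Proof. by rewrite !mxE; ring. Qed.

Lemma linf_oplusC z w : N (z - w) = N (w - z).
Proof. by rewrite -linf_oplusN opprB. Qed.

Lemma linf_oplusD z w : N (z + w) <= N z + N w.
Proof.
apply: linf_oplus_le => i j; rewrite !mxE addrACA.
by rewrite (le_trans (ler_normD _ _))// lerD// linf_oplus_ub.
Qed.

Lemma linf_oplus_tri w z t : N (z - t) <= N (z - w) + N (w - t).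
Proof. by rewrite -(subrKA w) linf_oplusD. Qed.

Lemma vmax_linf_oplus z : vmax z.1 + vmax z.2 <= N z.
Proof.
have [i ->] := vmax_attained z.1; have [j ->] := vmax_attained z.2.
by rewrite (le_trans (ler_norm _))// linf_oplus_ub.
Qed.

Lemma vmin_linf_oplus z : - N z <= vmin z.1 + vmin z.2.
Proof.
have [i ->] := vmin_attained z.1; have [j ->] := vmin_attained z.2.
by rewrite lerNl (le_trans _ (linf_oplus_ub z i j))// -normrN ler_norm.
Qed.

(** The two oscillations are nonnegative and add up to the sum of the maxima minus the sum of the
    minima. They are invariant under shifts [(r, - r)], so [N] controls them although it controls
    neither component. *)
Lemma osc_linf_oplus z : (vmax z.1 - vmin z.1 <= 2 * N z) /\
  (vmax z.2 - vmin z.2 <= 2 * N z).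
Proof.
have := vmax_linf_oplus z; have := vmin_linf_oplus z.
have := vmin_le_vmax z.1; have := vmin_le_vmax z.2.
by split; lra.
Qed.

(** Every [alpha_i + beta_j] lies between the sum of the minima and the sum of the maxima, and both
    ends are attained. *)
Lemma B_oplusE r z : B_oplus r z <-> N z <= r.
Proof.
rewrite /B_oplus /=; split=> [/and3P[rz _ zr]|Nr].
  apply: linf_oplus_le => i j; rewrite ler_norml.
  by rewrite (le_trans rz) ?(le_trans _ zr)// lerD// ?vmin_le// vmax_ge.
apply/and3P; split; last exact: le_trans (vmax_linf_oplus z) Nr.
  by apply: le_trans (vmin_linf_oplus z); rewrite lerN2.
by rewrite lerD// vmin_le_vmax.
Qed.

End linf_oplus_seminorm.

(** * Fixed points and linear convergence modulo shifts *)

(** The steps form an absolutely convergent series, and [s] is [s 0] plus its telescoping partial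
    sums. *)
Lemma cvg_geometric_steps (R : realType) (C q : R) (s : R^nat) :
  0 <= C -> 0 <= q < 1 -> (forall t, `|s t.+1 - s t| <= C * q ^+ t) -> cvgn s.
Proof.
move=> C0 /andP[q0 q1] sCq.
pose e t := s t.+1 - s t.
have cvge : cvgn (series e).
  apply: normed_cvg; apply: (@series_le_cvg _ _ (geometric C q)) => //.
  - by move=> t /=.
  - by move=> t; rewrite /geometric /= mulr_ge0// exprn_ge0.
  - by apply: is_cvg_geometric_series; rewrite ger0_norm.
have -> : s = (fun t => s 0%N + series e t).
  apply/funext => t; rewrite /series /=; elim: t => [|t IH].
    by rewrite big_geq// addr0.
  by rewrite big_nat_recr//= addrA -IH /e addrC subrK.
by apply: is_cvgD => //; exact: is_cvg_cst.
Qed.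

(* The iterates of [0] converge only modulo shifts [(r, - r)]; the limits [S]
   of their entries [alpha i + beta j] are realised by [alpha i := S i ord0]
   and [beta j := S ord0 j - S ord0 ord0]. *)
Section quotient_contraction.
Context (R : realType) (n m : nat).
Local Notation V := ('rV[R]_n.+1 * 'rV[R]_m.+1)%type.
Local Notation N := (@linf_oplus R n m).
Variables (F : V -> V) (w C : R).
Hypotheses (w01 : 0 <= w < 1) (C0 : 0 <= C).
Hypothesis F_growth : forall z, N (F z) <= w * N z + C.
Hypothesis F_lip : forall r : R, 0 <= r -> exists2 q : R, 0 <= q < 1 &
  forall z z', N z <= r -> N z' <= r -> N (F z - F z') <= q * N (z - z').
Hypothesis F_fix : forall z, N (F z - z) = 0 -> F z = z.

(** The fixed point of the affine growth bound [s |-> w * s + C]; this is why balls of radius at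
    least [M] are stable. *)
Let M := C / (1 - w).

Let M0 : 0 <= M.
Proof. by case/andP: w01 => _ w1; rewrite divr_ge0// subr_ge0 ltW. Qed.

Let ME : w * M + C = M.
Proof.
case/andP: w01 => _ w1; rewrite /M; field.
by rewrite subr_eq0 gt_eqF.
Qed.

Lemma iter_linf_oplus z t : N (iter t F z) <= w ^+ t * N z + M.
Proof.
case/andP: w01 => wge0 w1.
elim: t => [|t IH] /=; first by rewrite expr0 mul1r lerDl.
apply: le_trans (F_growth _) _.
rewrite -ME addrA lerD2r exprS -mulrA -mulrDr ler_wpM2l//.
Qed.

Lemma linf_oplus_stable r z : M <= r -> N z <= r -> N (F z) <= r.
Proof.
case/andP: w01 => wge0 w1 Mr zr; apply: le_trans (F_growth z) _.
have : w * N z <= w * r by rewrite ler_wpM2l.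
have : (1 - w) * M <= (1 - w) * r by rewrite ler_wpM2l// subr_ge0 ltW.
by have := ME; nra.
Qed.

Lemma contraction_on_B_oplus r : M <= r ->
  contraction_on N (@B_oplus R n m r) F.
Proof.
move=> Mr; split.
  by move=> z /B_oplusE zr; apply/B_oplusE; exact: linf_oplus_stable.
have [q q01 Fq] := F_lip (le_trans M0 Mr).
by exists q => // z z' /B_oplusE zr /B_oplusE zr'; exact: Fq.
Qed.

Let N0 : N 0 = 0.
Proof.
apply/eqP; rewrite eq_le linf_oplus_ge0 andbT.
by apply: linf_oplus_le => i j; rewrite !mxE addr0 normr0.
Qed.

Lemma iter0_linf_oplus t : N (iter t F 0) <= M.
Proof. by apply: le_trans (iter_linf_oplus _ _) _; rewrite N0 mulr0 add0r. Qed.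

Lemma iter0_cvg : exists z, forall e, 0 < e ->
  \forall t \near \oo, N (iter t F 0 - z) <= e.
Proof.
have [q q01 Fq] := F_lip M0.
have step t : N (iter t.+1 F 0 - iter t F 0) <= N (F 0) * q ^+ t.
  elim: t => [|t IH]; first by rewrite /= expr0 mulr1 subr0.
  rewrite /= in IH *; apply: le_trans (Fq _ _ _ _) _.
  - exact: (iter0_linf_oplus t.+1).
  - exact: iter0_linf_oplus.
  - by rewrite exprS mulrCA ler_wpM2l//; case/andP: q01.
pose s i j t := (iter t F 0).1 0 i + (iter t F 0).2 0 j.
have cs i j : cvgn (s i j).
  apply: (@cvg_geometric_steps _ (N (F 0)) q) => //; first exact: linf_oplus_ge0.
  move=> t; apply: le_trans (step t).
  apply: le_trans (linf_oplus_ub _ i j).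
  by rewrite /s !mxE opprD addrACA.
pose S i j := limn (s i j).
exists (\row_i S i ord0, \row_j (S ord0 j - S ord0 ord0)).
(* The additive structure [s i 0 + s 0 j - s 0 0 = s i j] of the entries passes to the limit, so the
   witness has all the limits [S i j] as its entries. *)
have SE i j : S i ord0 + (S ord0 j - S ord0 ord0) = S i j.
  have : (fun t => s i ord0 t + (s ord0 j t - s ord0 ord0 t)) @ \oo -->
      S i ord0 + (S ord0 j - S ord0 ord0).
    by apply: cvgD; [exact: cs|apply: cvgB; exact: cs].
  rewrite (_ : (fun t => _) = s i j); last by apply/funext => t; rewrite /s; ring.
  by move/(cvg_lim (@Rhausdorff R)).
move=> e e0.
have : \forall t \near \oo, forall ij : 'I_n.+1 * 'I_m.+1,
    `|s ij.1 ij.2 t - S ij.1 ij.2| <= e.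
  apply: filter_forall => -[i j] /=.
  have /cvgrPdist_le /(_ _ e0) := cs i j.
  by apply: filterS => t; rewrite distrC.
apply: filterS => t st; apply: linf_oplus_le => i j.
have := st (i, j); rewrite /= -SE /s !mxE; congr (`|_| <= _); ring.
Qed.

(** The orbit of [0] stays in the ball of radius [M], and its limit is within [1] of some iterate.
    On the ball of radius [M + 1] the Lipschitz bound gives [N (F z - z) = 0], and [F_fix] turns
    this into an equality. *)
Lemma quotient_fixed_point : exists2 z, F z = z & N z <= M + 1.
Proof.
have [z zP] := iter0_cvg.
have zM : N z <= M + 1.
  have [t _ /(_ t (leqnn t)) tz] := zP _ ltr01.
  rewrite -[z](subrK (iter t F 0)); apply: le_trans (linf_oplusD _ _) _.
  by rewrite addrC lerD ?iter0_linf_oplus// linf_oplusC.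
exists z => //; apply: F_fix; apply/eqP; rewrite eq_le linf_oplus_ge0 andbT.
have [q /andP[q0 q1] Fq] := F_lip (addr_ge0 M0 ler01).
apply/ler_addgt0Pr => e e0; rewrite add0r.
have [t _ tz] := zP (e / 2) ltac:(by rewrite divr_gt0).
have h1 := tz t (leqnn t); have h2 := tz t.+1 (leqnSn t).
rewrite /= in h1 h2.
apply: le_trans (linf_oplus_tri (iter t.+1 F 0) _ _) _.
rewrite (splitr e) lerD//= linf_oplusC.
apply: le_trans (Fq _ _ _ zM) _.
  by apply: le_trans (iter0_linf_oplus t) _; rewrite lerDl.
apply: le_trans _ h1; rewrite ler_piMl ?linf_oplus_ge0// ltW//.
Qed.

Lemma quotient_linear_convergence : exists (theta : R) (z : V),
  [/\ 0 < theta < 1, F z = z & forall z0 : V,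
    (fun t : nat => N (iter t F z0 - z)) =O_\oo (fun t : nat => theta ^+ t)].
Proof.
have [z Fz zM] := quotient_fixed_point.
have [q /andP[q0 q1] Fq] := F_lip (addr_ge0 M0 ler01).
(* The rate must be positive, whereas [q] may be [0]. *)
pose theta := Num.max q (1 / 2).
have th0 : 0 < theta by rewrite lt_max; apply/orP; right; lra.
exists theta, z; split => //; first by rewrite th0 gt_max q1; lra.
move=> z0; case/andP: (w01) => wge0 w1.
(* From time [t0] on the transient is at most [1], so the orbit stays in the ball of radius [M + 1],
   where [F] contracts. *)
have [t0 _ t0P] : \forall t \near \oo, w ^+ t * N z0 <= 1.
  have : (fun t => geometric (N z0) w t) @ \oo --> (0 : R).
    by apply: cvg_geometric; rewrite ger0_norm.
  move/cvgrPdist_le => /(_ _ ltr01); apply: filterS => t.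
  rewrite sub0r normrN mulrC; exact: le_trans (ler_norm _).
have tM t : (t0 <= t)%N -> N (iter t F z0) <= M + 1.
  move=> /t0P /= h; apply: le_trans (iter_linf_oplus _ _) _.
  by rewrite addrC lerD2l.
have decay k : N (iter (k + t0) F z0 - z) <= theta ^+ k * N (iter t0 F z0 - z).
  elim: k => [|k IH]; first by rewrite expr0 mul1r.
  rewrite addSn /= -[X in _ - X]Fz; apply: le_trans (Fq _ _ _ zM) _.
    by apply: tM; rewrite leq_addl.
  rewrite exprS -mulrA; apply: ler_pM => //; first exact: linf_oplus_ge0.
  by rewrite le_max lexx.
(* Dividing by [theta ^+ t0] absorbs the entrance time; [+ 1] makes the constant positive. *)
apply/eqO_exP; exists (N (iter t0 F z0 - z) / theta ^+ t0 + 1).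
  by rewrite ltr_wpDl// divr_ge0 ?linf_oplus_ge0// exprn_ge0// ltW.
exists t0 => // t /= t0t; rewrite (ger0_norm (linf_oplus_ge0 _)) ger0_norm ?exprn_ge0 ?(ltW th0)//.
rewrite -(subnK t0t); apply: le_trans (decay _) _.
rewrite mulrC exprD mulrDl mul1r.
have th0' := exprn_gt0 t0 th0.
rewrite (mulrC (theta ^+ _) (theta ^+ t0)) mulrA divfK ?gt_eqF// lerDl.
by rewrite mulr_ge0// ?exprn_ge0// ltW.
Qed.

End quotient_contraction.

(** * Log-sum-exp estimates *)

Section log_sum_exp.
Context (R : realType) (n : nat) (lam : R).
Hypothesis lam1 : 1 < lam.
Implicit Types (s : 'I_n.+1 -> R) (al : 'rV[R]_n.+1).

Let lam0 : 0 < lam. Proof. exact: lt_trans lam1. Qed.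

Definition sumexp s al := \sum_(i < n.+1) expR (lam * s i + lam * al 0 i).

(** The logarithm of [phi], with [s i] in place of the inner product with the [i]-th point. *)
Definition lse s al := 1 / lam * ln (sumexp s al).

Lemma sumexp_gt0 s al : 0 < sumexp s al.
Proof.
rewrite /sumexp big_ord_recl ltr_pwDl ?expR_gt0//.
by apply: sumr_ge0 => i _; exact: expR_ge0.
Qed.

Lemma expR_lse s al : expR (lam * lse s al) = sumexp s al.
Proof.
rewrite /lse mulrA div1r divff ?gt_eqF// mul1r lnK//.
by rewrite posrE sumexp_gt0.
Qed.

Lemma powR_sumexp s al : sumexp s al `^ (1 / lam) = expR (lse s al).
Proof. by rewrite /powR gt_eqF// sumexp_gt0. Qed.

Lemma lse_ler s al t : sumexp s al <= expR (lam * t) -> lse s al <= t.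
Proof. by rewrite -expR_lse ler_expR ler_pM2l. Qed.

Lemma ler_lse s al t : expR (lam * t) <= sumexp s al -> t <= lse s al.
Proof. by rewrite -expR_lse ler_expR ler_pM2l. Qed.

(** Bounding each of the [n.+1] terms by the largest costs [ln n.+1%:R / lam], which is at most
    [ln n.+1%:R] because [1 < lam]. *)
Lemma lse_le_vmax s al (g : R) : (forall i, `|s i| <= g) ->
  lse s al <= vmax al + g + ln n.+1%:R.
Proof.
move=> sg; apply: lse_ler.
apply: (@le_trans _ _ (\sum_(i < n.+1) expR (lam * (vmax al + g)))).
  apply: ler_sum => i _; rewrite ler_expR -mulrDr ler_pM2l// addrC lerD//.
    exact: vmax_ge.
  exact: le_trans (ler_norm _) (sg i).
rewrite sumr_const card_ord -[leLHS]mulr_natr [in leRHS]mulrDr [in leRHS]expRD.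
rewrite ler_pM2l ?expR_gt0//.
rewrite -[leLHS]lnK ?posrE// ler_expR ler_peMl ?(ltW lam1)//.
by rewrite ln_ge0// ler1n.
Qed.

Lemma lse_ge_vmax s al (g : R) : (forall i, `|s i| <= g) -> vmax al - g <= lse s al.
Proof.
move=> sg; apply: ler_lse; have [k ->] := vmax_attained al.
rewrite /sumexp (bigD1 k)//=; apply: ler_wpDr.
  by apply: sumr_ge0 => i _; exact: expR_ge0.
rewrite ler_expR -mulrDr ler_pM2l// addrC lerD2r.
by rewrite lerNl (le_trans _ (sg k))// -normrN ler_norm.
Qed.

Lemma sumexp_split s al al' : sumexp s al =
  \sum_(i < n.+1) expR (lam * s i + lam * al' 0 i) *
                  expR (lam * (al 0 i - al' 0 i)).
Proof. by apply: eq_bigr => i _; rewrite -expRD; congr expR; ring. Qed.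

Lemma lse_le_shift s al al' (t : R) : (forall i, al 0 i - al' 0 i <= t) ->
  lse s al <= t + lse s al'.
Proof.
move=> alt; apply: lse_ler; rewrite mulrDr expRD expR_lse (sumexp_split s al al').
rewrite mulr_sumr ler_sum// => i _; rewrite mulrC ler_pM2r ?expR_gt0//.
by rewrite ler_expR ler_pM2l.
Qed.

(** Convexity of the exponential. The bounds [1 + s <= expR s] at [(1 - r) * t] and [- (r * t)],
    weighted by [r] and [1 - r], lose their linear terms; it remains to multiply by
    [expR (r * t)]. *)
Lemma expR_chord (r t : R) : 0 <= r <= 1 -> expR (r * t) <= 1 + r * (expR t - 1).
Proof.
move=> /andP[r0 r1].
have h1 : 1 + (1 - r) * t <= expR ((1 - r) * t) by exact: expR_ge1Dx.
have h2 : 1 - r * t <= expR (- (r * t)) by exact: expR_ge1Dx.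
have h : 1 <= r * expR ((1 - r) * t) + (1 - r) * expR (- (r * t)).
  have := ler_wpM2l r0 h1.
  have : (1 - r) * (1 - r * t) <= (1 - r) * expR (- (r * t)).
    by rewrite ler_wpM2l// subr_ge0.
  by move=> ? ?; lra.
have := ler_wpM2r (expR_ge0 (r * t)) h; rewrite mul1r mulrDl -!mulrA -!expRD.
by rewrite addNr expR0 -mulrDl subrK mul1r => H; apply: le_trans H _; lra.
Qed.

(* The index [k] carries at least the fraction [r] of the weight of [sumexp],
   so that raising the lower bound on [al - al'] at [k] alone already lifts the
   softmax average of [al - al'] by [r] times the excess. *)
Lemma lse_gain s al al' (g lo D : R) k : (forall i, `|s i| <= g) ->
  (forall i, lo <= al 0 i - al' 0 i) -> (forall i, al' 0 i - al' 0 k <= D) ->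
  lo + expR (- (2 * lam * g + lam * D + ln n.+1%:R)) *
         (al 0 k - al' 0 k - lo) <= lse s al - lse s al'.
Proof.
move=> sg lole alD; rewrite lerBrDr; apply: ler_lse.
set e := (X in expR (- X)); set r := expR (- e).
pose w i := expR (lam * s i + lam * al' 0 i).
(* Each of the [n.+1] terms exceeds [w k] by a factor of at most [expR (2 * lam * g + lam * D)]. *)
have rw : r * sumexp s al' <= w k.
  rewrite /r expRN ler_pdivrMl ?expR_gt0//.
  rewrite /e expRD lnK ?posrE// mulrAC mulr_natr.
  rewrite -[X in _ <= _ *+ X](card_ord n.+1) -sumr_const.
  apply: ler_sum => i _; rewrite /w -expRD ler_expR -subr_ge0.
  have := alD i; have := sg i; have := sg k.
  rewrite !ler_norml => /andP[k1 _] /andP[_ k2] k3.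
  set X := (X in 0 <= X).
  have -> : X = lam * ((g + s k) + (g - s i) + (D - (al' 0 i - al' 0 k))).
    by rewrite /X; ring.
  by rewrite mulr_ge0 ?(ltW lam0)//; lra.
have r01 : 0 <= r <= 1.
  rewrite expR_ge0 /= -(ler_pM2r (sumexp_gt0 s al')) mul1r.
  apply: le_trans rw _; rewrite /sumexp (bigD1 k)//= lerDl.
  by apply: sumr_ge0 => i _; exact: expR_ge0.
set x := al 0 k - al' 0 k - lo.
have x0 : 0 <= x by rewrite subr_ge0.
rewrite 2!mulrDr !expRD expR_lse (sumexp_split s al al').
(* The intermediate value is [sumexp s al] with [al - al'] lowered to [lo] at every index but [k].
   The chord inequality with weight [r] compares it with the left-hand side. *)
apply: (@le_trans _ _ (expR (lam * lo) *
    (sumexp s al' + w k * (expR (lam * x) - 1)))).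
  rewrite -mulrA ler_pM2l ?expR_gt0//.
  rewrite (mulrCA lam) mulrC.
  apply: le_trans (ler_wpM2l (ltW (sumexp_gt0 s al')) (expR_chord _ r01)) _.
  rewrite mulrDr mulr1 lerD2l mulrA ler_wpM2r//; last by rewrite mulrC.
  by rewrite subr_ge0 -expR0 ler_expR mulr_ge0// ltW.
rewrite mulrDr (bigD1 k)//= /sumexp (bigD1 k)//= -/(w k).
rewrite [in leLHS]mulrDr addrAC lerD//.
  rewrite -mulrDr mulrBr mulr1 addrC subrK mulrCA ler_pM2l ?expR_gt0//.
  by rewrite -expRD -mulrDr /x addrC subrK.
rewrite mulr_sumr ler_sum// => i _; rewrite mulrC ler_pM2l ?expR_gt0//.
by rewrite ler_expR ler_pM2l.
Qed.

End log_sum_exp.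

(** * Positivity of integrals and bounds on logarithms *)

Section positive_integral.
Context d (T : measurableType d) (R : realType) (mu : {measure set T -> \bar R}).

(** If the integral vanished, [f] would be zero almost everywhere, so the whole space would lie in a
    null set. *)
Lemma Rintegral_gt0 (f : T -> R) : mu setT != 0%E ->
  mu.-integrable setT (EFin \o f) -> (forall z, 0 < f z) ->
  0 < \int[mu]_z f z.
Proof.
move=> mu0 fint f0; rewrite lt_neqAle Rintegral_ge0 ?andbT//; last first.
  by move=> z _; exact: ltW.
apply: contra mu0 => /eqP If0.
have : (\int[mu]_z `|(EFin \o f) z| = 0)%E.
  transitivity (\int[mu]_z (EFin \o f) z)%E.
    by apply: eq_integral => z _ /=; rewrite gtr0_norm.
  by rewrite -(fineK (integrable_fin_num measurableT fint)); congr _%:E.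
move/(ae_eq_integral_abs mu measurableT (measurable_int mu fint)).1 => -[N [mN N0 sN]].
rewrite -measure_le0 -N0 le_measure ?inE// => z _; apply: sN => /= /(_ I) [fz].
by have := f0 z; rewrite fz ltxx.
Qed.

End positive_integral.

Section ln_bounds.
Context (R : realType).
Implicit Types I A a h k t c : R.

Lemma ln_le_expR_mul I A t : 0 < I -> 0 < A ->
  I <= expR t * A -> ln I <= t + ln A.
Proof.
move=> I0 A0 IA; rewrite -(expRK t) -lnM ?posrE ?expR_gt0//.
by rewrite ler_ln ?posrE ?mulr_gt0// expR_gt0.
Qed.

Lemma expR_mul_le_ln I A t : 0 < I -> 0 < A ->
  expR t * A <= I -> t + ln A <= ln I.
Proof.
move=> I0 A0 IA; rewrite -(expRK t) -lnM ?posrE ?expR_gt0//.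
by rewrite ler_ln ?posrE ?mulr_gt0// expR_gt0.
Qed.

Lemma dist_le_of_bounds I h c k a b : 0 <= c -> 0 <= k ->
  h - k + a <= I -> I <= h + c + b -> `|I - h| <= c + k + `|a| + `|b|.
Proof.
move=> c0 k0 lb ub; have := ler_norm b; have := ler_norm (- a).
rewrite normrN; have := normr_ge0 a; have := normr_ge0 b.
by rewrite ler_norml; lra.
Qed.

(** Apply [ln (1 + s) <= s] to [(1 + c)^-1 = 1 - c / (1 + c)]. *)
Lemma ln1D_ge c : 0 <= c -> c / (1 + c) <= ln (1 + c).
Proof.
move=> c0; have c1 : 0 < 1 + c by rewrite ltr_pwDl.
rewrite -lerN2 -lnV ?posrE//.
have e : (1 + c)^-1 = 1 + - (c / (1 + c)) by field; rewrite gt_eqF.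
rewrite [in leLHS]e.
by apply: le_ln1Dx; rewrite ltrN2 ltr_pdivrMr// mul1r ltr_pwDl.
Qed.

(** For [s <= D] the logarithm of [1 + k * s] grows at least linearly in [s], with slope
    [k / (1 + k * D)]. The cap at [1] prepares the hypothesis [k <= 1] of [contraction_arith]. *)
Lemma ln_gain I A h k s D : 0 < I -> 0 < A -> 0 < k -> 0 <= s <= D ->
  expR h * (A * (1 + k * s)) <= I ->
  h + Num.min 1 (k / (1 + k * D)) * s <= ln I - ln A.
Proof.
move=> I0 A0 k0 /andP[s0 sD] gain.
have ks0 : 0 <= k * s by rewrite mulr_ge0// ltW.
have ks1 : 0 < 1 + k * s by rewrite ltr_pwDl.
have kD1 : 0 < 1 + k * D.
  by rewrite (lt_le_trans ks1)// lerD2l ler_pM2l.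
have := expR_mul_le_ln I0 (mulr_gt0 A0 ks1) gain.
rewrite lnM ?posrE// => lnI.
have := ln1D_ge ks0.
have : Num.min 1 (k / (1 + k * D)) * s <= k * s / (1 + k * s).
  rewrite mulrAC ler_wpM2r// ge_min; apply/orP; right.
  by rewrite ler_pM2l// lef_pV2 ?posrE// lerD2l ler_pM2l.
lra.
Qed.

End ln_bounds.

(** * Integrals of exponentiated potentials *)

Section log_sum_exp_integrals.
Context d (T : measurableType d) (R : realType) (mu : {measure set T -> \bar R}).
Context (lam : R) (G : T -> R).
Hypotheses (lam1 : 1 < lam) (mG : measurable_fun setT G) (mu0 : mu setT != 0%E).
Hypothesis Gint : forall C, mu.-integrable setT (EFin \o (fun z => expR (C * G z))).

Let lam0 : 0 < lam. Proof. exact: lt_trans lam1. Qed.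

Lemma integrable_expR_le (f : T -> R) (K C : R) : measurable_fun setT f ->
  (forall z, f z <= K + C * G z) ->
  mu.-integrable setT (EFin \o (fun z => expR (f z))).
Proof.
move=> mf fK.
apply: le_integrable (integrableZl measurableT (expR K) (Gint C)) => //.
  by apply/measurable_EFinP; exact: measurableT_comp.
move=> z _ /=; rewrite -expRD lee_fin !ger0_norm ?expR_ge0//.
by rewrite ler_expR.
Qed.

Lemma Rintegral_expG_gt0 C : 0 < \int[mu]_z expR (C * G z).
Proof. by apply: Rintegral_gt0 => // z; exact: expR_gt0. Qed.

Lemma measurable_lse n (u : 'I_n.+1 -> T -> R) al :
  (forall i, measurable_fun setT (u i)) ->
  measurable_fun setT (fun z => lse lam (u^~ z) al).
Proof.
move=> meas_u; apply: measurable_funM => //; apply: measurableT_comp => //.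
apply: measurable_sum => i; apply: measurableT_comp => //.
by apply: measurable_funD => //; apply: measurable_funM.
Qed.

Section one_side.
Context n m (u : 'I_n.+1 -> T -> R) (v : 'I_m.+1 -> T -> R).
Hypotheses (meas_u : forall i, measurable_fun setT (u i))
  (meas_v : forall j, measurable_fun setT (v j))
  (uG : forall i z, `|u i z| <= G z) (vG : forall j z, `|v j z| <= G z).
Implicit Types (al : 'rV[R]_n.+1) (be : 'rV[R]_m.+1).

(** The logarithm of the integrand defining [alpha'_i], with [u] and [v] for the inner products.
    Exchanging [u] with [v] and [al] with [be] gives the integrand of [beta'_j]. *)
Definition lse_pot al be i z :=
  (1 - lam) * lse lam (u^~ z) al + lse lam (v^~ z) be + lam * u i z.

Definition lse_int al be i := \int[mu]_z expR (lse_pot al be i z).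

(** The leading part of [lse_pot], with each [lse] replaced by a maximum; the remainder is bounded
    in terms of [G z], uniformly in [al] and [be]. *)
Definition vmax_pot al be := (1 - lam) * vmax al + vmax be.

Let c : R := ln n.+1%:R + ln m.+1%:R.

Let lnS_ge0 k : 0 <= ln k.+1%:R :> R.
Proof. by rewrite ln_ge0// ler1n. Qed.

(** Since [1 - lam < 0], the first [lse] must be bounded from below. The three terms contribute
    [lam - 1], [1] and [lam] times [G z]. *)
Lemma lse_pot_le al be i z :
  lse_pot al be i z <= vmax_pot al be + c + 2 * lam * G z.
Proof.
have h1 := @lse_ge_vmax _ _ _ lam1 (u^~ z) al (G z) (uG^~ z).
have h2 := @lse_le_vmax _ _ _ lam1 (v^~ z) be (G z) (vG^~ z).
have h3 : lam * u i z <= lam * G z.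
  by rewrite ler_pM2l// (le_trans (ler_norm _)).
have h4 : (lam - 1) * (vmax al - G z) <= (lam - 1) * lse lam (u^~ z) al.
  by rewrite ler_wpM2l// subr_ge0 ltW.
have := lnS_ge0 n; rewrite /lse_pot /vmax_pot /c; lra.
Qed.

Lemma lse_pot_ge al be i z :
  vmax_pot al be - lam * c - 2 * lam * G z <= lse_pot al be i z.
Proof.
have h1 := @lse_le_vmax _ _ _ lam1 (u^~ z) al (G z) (uG^~ z).
have h2 := @lse_ge_vmax _ _ _ lam1 (v^~ z) be (G z) (vG^~ z).
have h3 : - (lam * G z) <= lam * u i z.
  rewrite -mulrN ler_pM2l// lerNl (le_trans _ (uG i z))//.
  by rewrite -normrN ler_norm.
have h4 : (lam - 1) * lse lam (u^~ z) al <=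
    (lam - 1) * (vmax al + G z + ln n.+1%:R).
  by rewrite ler_wpM2l// subr_ge0 ltW.
have h5 : 0 <= lam * ln m.+1%:R by rewrite mulr_ge0// ltW.
have := lnS_ge0 n; rewrite /lse_pot /vmax_pot /c; lra.
Qed.

Lemma measurable_lse_pot al be i : measurable_fun setT (lse_pot al be i).
Proof.
apply: measurable_funD; last exact: measurable_funM.
apply: measurable_funD; last exact: measurable_lse.
by apply: measurable_funM => //; exact: measurable_lse.
Qed.

Lemma integrable_lse_pot al be i :
  mu.-integrable setT (EFin \o (fun z => expR (lse_pot al be i z))).
Proof.
apply: integrable_expR_le (measurable_lse_pot _ _ _) _ => z.
exact: lse_pot_le.
Qed.

Lemma lse_int_gt0 al be i : 0 < lse_int al be i.
Proof.
apply: Rintegral_gt0 => //; first exact: integrable_lse_pot.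
by move=> z; exact: expR_gt0.
Qed.

Lemma lse_int_le al be i : lse_int al be i <=
  expR (vmax_pot al be + c) * \int[mu]_z expR (2 * lam * G z).
Proof.
rewrite -RintegralZl//; apply: le_Rintegral => //.
- exact: integrable_lse_pot.
- under eq_fun do rewrite /comp -expRD.
  by apply: (@integrable_expR_le _ _ (2 * lam)) => //;
    apply: measurable_funD => //; apply: measurable_funM.
- by move=> z _; rewrite -expRD ler_expR lse_pot_le.
Qed.

Lemma lse_int_ge al be i :
  expR (vmax_pot al be - lam * c) * \int[mu]_z expR (- (2 * lam) * G z) <=
  lse_int al be i.
Proof.
rewrite -RintegralZl//; apply: le_Rintegral => //.
- under eq_fun do rewrite /comp -expRD.
  by apply: (@integrable_expR_le _ _ (- (2 * lam))) => //;
    apply: measurable_funD => //; apply: measurable_funM.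
- exact: integrable_lse_pot.
- by move=> z _; rewrite -expRD ler_expR mulNr lse_pot_ge.
Qed.

(** In the integrated bounds on [lse_pot] the dependence on [al] and [be] factors out, leaving
    integrals of [G] alone. *)
Lemma ln_lse_int_bounded : exists2 L : R, 0 <= L & forall al be i,
  `|ln (lse_int al be i) - vmax_pot al be| <= L.
Proof.
set A := \int[mu]_z expR (- (2 * lam) * G z).
set B := \int[mu]_z expR (2 * lam * G z).
have A0 : 0 < A by exact: Rintegral_expG_gt0.
have B0 : 0 < B by exact: Rintegral_expG_gt0.
have c0 : 0 <= c by rewrite addr_ge0.
have lc0 : 0 <= lam * c by rewrite mulr_ge0// ltW.
exists (c + lam * c + `|ln A| + `|ln B|); first by rewrite !addr_ge0.
move=> al be i.
have I0 := lse_int_gt0 al be i.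
have /(ln_le_expR_mul I0 B0) := lse_int_le al be i.
have /(expR_mul_le_ln I0 A0) := lse_int_ge al be i.
by move=> ? ?; exact: dist_le_of_bounds.
Qed.

(* Pointwise, the integrand grows at least by the factor
   [expR (h0 + rho * s) >= expR h0 * (1 + rho * s)]; the bounds on [lse_pot]
   turn the integral of [rho * s] into a multiple of [s * lse_int]. *)
Lemma ln_lse_int_gain D : 0 <= D -> exists2 k : R, 0 < k <= 1 &
  forall al be al' be' i, vmax be' - vmin be' <= D ->
  vmax (be - be') - vmin (be - be') <= D ->
  (1 - lam) * vmax (al - al') + vmin (be - be') +
    k * (vmax (be - be') - vmin (be - be')) <=
  ln (lse_int al be i) - ln (lse_int al' be' i).
Proof.
move=> D0.
set B := \int[mu]_z expR (2 * lam * G z).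
set K := \int[mu]_z expR (- (4 * lam) * G z).
have B0 : 0 < B by exact: Rintegral_expG_gt0.
have K0 : 0 < K by exact: Rintegral_expG_gt0.
(* In the lower bound for [rho * expR (lse_pot al' be' i z)], the weight [rho] contributes
   [lam * D + c] and [lse_pot_ge] contributes [lam * c]; each also gives [2 * lam * G z], hence the
   [4 * lam] in [K]. *)
pose e := lam * D + c + lam * c.
(* Chosen so that [lse_int_le] yields [kap * lse_int al' be' i <= expR (h' - e) * K]. *)
pose kap := expR (- (e + c)) * K / B.
have kap0 : 0 < kap by rewrite divr_gt0// mulr_gt0// expR_gt0.
have kD0 : 0 <= kap * D by rewrite mulr_ge0// ltW.
have kD1 : 0 < 1 + kap * D by rewrite ltr_pwDl.
exists (Num.min 1 (kap / (1 + kap * D))).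
  by rewrite lt_min ltr01 divr_gt0//= ge_min lexx.
move=> al be al' be' i be'D dbeD.
set hi := vmax (be - be'); set lo := vmin (be - be').
pose s := hi - lo.
have s0 : 0 <= s by rewrite subr_ge0 vmin_le_vmax.
pose h0 := (1 - lam) * vmax (al - al') + lo.
pose h' := vmax_pot al' be'.
have pot_gain z : expR h0 * (expR (lse_pot al' be' i z) +
    s * expR (h' - e) * expR (- (4 * lam) * G z)) <= expR (lse_pot al be i z).
  pose rho := expR (- (2 * lam * G z + lam * D + c)).
  have g1 : lse lam (u^~ z) al <= vmax (al - al') + lse lam (u^~ z) al'.
    apply: lse_le_shift => // k.
    by have := vmax_ge (al - al') k; rewrite !mxE.
  have g2 : lo + rho * s <= lse lam (v^~ z) be - lse lam (v^~ z) be'.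
    have [k hik] := vmax_attained (be - be').
    have := @lse_gain _ _ _ lam1 (v^~ z) be be' (G z) lo D k (vG^~ z).
    move=> H; apply: le_trans (H _ _).
    - rewrite lerD2l /s /hi hik !mxE ler_wpM2r//.
        by have := s0; rewrite /s /hi hik !mxE.
      by rewrite ler_expR lerN2 /c; have := lnS_ge0 n; lra.
    - by move=> j; have := vmin_le (be - be') j; rewrite !mxE.
    - move=> j; apply: le_trans be'D.
      by rewrite lerB ?vmax_ge// vmin_le.
  have g3 : h0 + rho * s + lse_pot al' be' i z <= lse_pot al be i z.
    have : (lam - 1) * lse lam (u^~ z) al <=
        (lam - 1) * (vmax (al - al') + lse lam (u^~ z) al').
      by rewrite ler_wpM2l// subr_ge0 ltW.
    by rewrite /lse_pot /h0; lra.
  apply: (@le_trans _ _ (expR (h0 + rho * s + lse_pot al' be' i z))); last first.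
    by rewrite ler_expR.
  rewrite [in leRHS]expRD [in leRHS]expRD -[leRHS]mulrA ler_pM2l ?expR_gt0//.
  apply: (@le_trans _ _ ((1 + rho * s) * expR (lse_pot al' be' i z))); last first.
    by rewrite ler_pM2r ?expR_gt0// expR_ge1Dx.
  rewrite [in leRHS]mulrDl mul1r lerD2l (mulrC rho) -!mulrA ler_wpM2l//.
  rewrite /rho -!expRD ler_expR.
  by have := lse_pot_ge al' be' i z; rewrite /h' /e; lra.
have int_gain : expR h0 * (lse_int al' be' i * (1 + kap * s)) <= lse_int al be i.
  apply: (@le_trans _ _ (expR h0 * (lse_int al' be' i + s * expR (h' - e) * K))).
    rewrite ler_pM2l ?expR_gt0// mulrDr mulr1 lerD2l (mulrC kap) mulrCA -mulrA.
    rewrite ler_wpM2l//.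
    apply: le_trans (ler_wpM2r (ltW kap0) (lse_int_le _ _ _)) _.
    have -> : expR (h' - e) = expR (h' + c) * expR (- (e + c)).
      by rewrite -expRD; congr expR; ring.
    rewrite -/B /kap -/h' le_eqVlt; apply/orP; left; apply/eqP; field.
    by rewrite gt_eqF.
  have i1 := integrable_lse_pot al' be' i.
  have i2 := Gint (- (4 * lam)).
  have i3 := integrableZl measurableT (s * expR (h' - e)) i2.
  pose f z := expR (lse_pot al' be' i z) +
    s * expR (h' - e) * expR (- (4 * lam) * G z).
  have i4 : mu.-integrable setT (EFin \o f) by exact: (integrableD _ i1 i3).
  have i5 : mu.-integrable setT (EFin \o (fun z => expR h0 * f z)).
    by move: i4 => /(integrableZl measurableT (expR h0)).
  have -> : expR h0 * (lse_int al' be' i + s * expR (h' - e) * K) =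
      \int[mu]_z (expR h0 * f z).
    rewrite (RintegralZl _ measurableT i4) (RintegralD measurableT i1 i3).
    by rewrite (RintegralZl _ measurableT i2).
  apply: (le_Rintegral measurableT i5 (integrable_lse_pot al be i)) => z _.
  exact: pot_gain.
apply: ln_gain (lse_int_gt0 _ _ _) (lse_int_gt0 _ _ _) kap0 _ int_gain.
by rewrite s0.
Qed.

(* Summing over [i] cancels the power [1 - lam], leaving an expression
   symmetric in the two marginals. *)
Lemma sum_lse_int al be : \sum_(i < n.+1) expR (lam * al 0 i) * lse_int al be i =
  \int[mu]_z expR (lse lam (u^~ z) al + lse lam (v^~ z) be).
Proof.
pose f i z := expR (lam * al 0 i) * expR (lse_pot al be i z).
have fint i : mu.-integrable setT (EFin \o f i).
  exact: (integrableZl measurableT _ (integrable_lse_pot al be i)).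
transitivity (\sum_(i < n.+1) \int[mu]_z f i z).
  by apply: eq_bigr => i _; rewrite -RintegralZl//; exact: integrable_lse_pot.
transitivity (\int[mu]_z \sum_(i < n.+1) f i z).
  rewrite /Rintegral -[LHS]/(fine (_)%:E) EFin_sum_fine; last first.
    by move=> i _; exact: (integrable_fin_num measurableT (fint i)).
  rewrite -(integral_sum measurableT fint); congr fine.
  by apply: eq_integral => z _; rewrite -sumEFin.
apply: eq_Rintegral => z _; rewrite /f.
transitivity (expR ((1 - lam) * lse lam (u^~ z) al + lse lam (v^~ z) be) *
    sumexp lam (u^~ z) al).
  rewrite mulr_sumr; apply: eq_bigr => i _; rewrite -!expRD; congr expR.
  by rewrite /lse_pot; ring.
by rewrite -expR_lse// -expRD; congr expR; ring.
Qed.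

End one_side.
End log_sum_exp_integrals.

(** * Arithmetic of the growth and contraction constants *)

Section contraction_arithmetic.
Context (R : realType) (lam : R).
Hypothesis lam2 : 2 < lam.

(** The leading terms add up to [(2 - lam) * (p + q)], where [p] and [q] are the maxima of the two
    components. *)
Lemma growth_arith (A B L1 L2 D p q la lb lI lJ : R) :
  - D <= p + q -> p + q <= D -> `|la| <= A -> `|lb| <= B ->
  `|lI - ((1 - lam) * p + q)| <= L1 -> `|lJ - ((1 - lam) * q + p)| <= L2 ->
  `|la + lb - (lI + lJ)| <= (lam - 2) * D + (A + B + L1 + L2).
Proof.
move=> Dl Du; rewrite !ler_norml.
move=> /andP[? ?] /andP[? ?] /andP[? ?] /andP[? ?].
have l2 : 0 <= lam - 2 by rewrite subr_ge0 ltW.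
have := ler_wpM2l l2 Dl; have := ler_wpM2l l2 Du => ? ?.
by apply/andP; split; lra.
Qed.

(** With [k1] and [k2] lowered to [k], the lower bounds add up to [- (lam - 1 - k) * (a1 + b1) + (1
    - k) * (a0 + b0)]. As [k <= 1 < lam - 1], both [lam - 1 - k] and [1 - k] are nonnegative, and
    they sum to [lam - 2 * k]. *)
Lemma contraction_arith (D k k1 k2 a0 a1 b0 b1 dI dJ : R) :
  k <= 1 -> k <= k1 -> k <= k2 -> a0 <= a1 -> b0 <= b1 ->
  a1 + b1 <= D -> - D <= a0 + b0 ->
  (1 - lam) * a1 + b0 + k1 * (b1 - b0) <= dI ->
  (1 - lam) * b1 + a0 + k2 * (a1 - a0) <= dJ ->
  - (dI + dJ) <= (lam - 2 * k) * D.
Proof.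
move=> k_le1 kk1 kk2 a01 b01 mx mn g1 g2; move: lam2 => l2.
have h1 : k * (b1 - b0) <= k1 * (b1 - b0) by rewrite ler_wpM2r// subr_ge0.
have h2 : k * (a1 - a0) <= k2 * (a1 - a0) by rewrite ler_wpM2r// subr_ge0.
have h3 : (lam - 1 - k) * (a1 + b1) <= (lam - 1 - k) * D.
  by rewrite ler_wpM2l//; lra.
have h4 : (1 - k) * (- D) <= (1 - k) * (a0 + b0).
  by rewrite ler_wpM2l//; lra.
lra.
Qed.

End contraction_arithmetic.

(** * The iteration map in abstract form *)

Section log_sum_exp_iteration.
Context d (T : measurableType d) (R : realType) (mu : {measure set T -> \bar R}).
Context (lam : R) (G : T -> R).
Hypotheses (lam2 : 2 < lam) (mG : measurable_fun setT G) (mu0 : mu setT != 0%E).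
Hypothesis Gint : forall C, mu.-integrable setT (EFin \o (fun z => expR (C * G z))).
Context n m (u : 'I_n.+1 -> T -> R) (v : 'I_m.+1 -> T -> R).
Hypotheses (meas_u : forall i, measurable_fun setT (u i))
  (meas_v : forall j, measurable_fun setT (v j))
  (uG : forall i z, `|u i z| <= G z) (vG : forall j z, `|v j z| <= G z).
Context (a : 'I_n.+1 -> R) (b : 'I_m.+1 -> R).
Hypotheses (a0 : forall i, 0 < a i) (b0 : forall j, 0 < b j).
Hypothesis ab_sum : \sum_(i < n.+1) a i = \sum_(j < m.+1) b j.

Local Notation V := ('rV[R]_n.+1 * 'rV[R]_m.+1)%type.
Local Notation N := (@linf_oplus R n m).
Local Notation I z i := (lse_int mu lam u v z.1 z.2 i).
Local Notation J z j := (lse_int mu lam v u z.2 z.1 j).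

Let lam1 : 1 < lam. Proof. by apply: lt_trans lam2; rewrite ltr1n. Qed.
Let lam0 : 0 < lam. Proof. exact: lt_trans lam1. Qed.

Local Opaque lse_int.

(** [Psi] for abstract [mu], [u] and [v]. As [J] is [I] with the two sides exchanged, each estimate
    on the integrals serves twice. *)
Definition lse_step (z : V) : V :=
  (\row_i (1 / lam * ln (a i) - 1 / lam * ln (I z i)),
   \row_j (1 / lam * ln (b j) - 1 / lam * ln (J z j))).

Lemma lse_step1 z i :
  (lse_step z).1 0 i = 1 / lam * ln (a i) - 1 / lam * ln (I z i).
Proof. by rewrite mxE. Qed.

Lemma lse_step2 z j :
  (lse_step z).2 0 j = 1 / lam * ln (b j) - 1 / lam * ln (J z j).
Proof. by rewrite mxE. Qed.

Local Opaque lse_step.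

Lemma lse_step_sum z i j : (lse_step z).1 0 i + (lse_step z).2 0 j =
  (ln (a i) + ln (b j) - (ln (I z i) + ln (J z j))) / lam.
Proof.
have num p q s t : 1 / lam * p - 1 / lam * s + (1 / lam * q - 1 / lam * t) =
  (p + q - (s + t)) / lam by ring.
by rewrite lse_step1 lse_step2; exact: num.
Qed.

Lemma lse_step_sumB z w i j :
  (lse_step z - lse_step w).1 0 i + (lse_step z - lse_step w).2 0 j =
  - ((ln (I z i) - ln (I w i)) + (ln (J z j) - ln (J w j))) / lam.
Proof.
have num p s t s' t' : (p - (s + t)) / lam - (p - (s' + t')) / lam =
  - ((s - s') + (t - t')) / lam by ring.
apply: etrans (sum_coordB _ _ _ _) _.
exact: etrans (congr2 (fun s t => s - t) (lse_step_sum z i j) (lse_step_sum w i j))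
  (num _ _ _ _ _).
Qed.

Lemma lse_step_growth : exists2 C : R, 0 <= C &
  forall z, N (lse_step z) <= (1 - 2 / lam) * N z + C.
Proof.
have [L1 L10 L1P] :=
  @ln_lse_int_bounded _ _ _ mu lam G lam1 mG mu0 Gint _ _ u v meas_u meas_v uG vG.
have [L2 L20 L2P] :=
  @ln_lse_int_bounded _ _ _ mu lam G lam1 mG mu0 Gint _ _ v u meas_v meas_u vG uG.
pose A := \sum_(i < n.+1) `|ln (a i)|; pose B := \sum_(j < m.+1) `|ln (b j)|.
have A0 : 0 <= A by apply: sumr_ge0.
have B0 : 0 <= B by apply: sumr_ge0.
exists ((A + B + L1 + L2) / lam); first by rewrite divr_ge0 ?(ltW lam0)// !addr_ge0.
move=> z; apply: linf_oplus_le => i j.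
have aA : `|ln (a i)| <= A by rewrite /A (bigD1 i)//= lerDl sumr_ge0.
have bB : `|ln (b j)| <= B by rewrite /B (bigD1 j)//= lerDl sumr_ge0.
rewrite lse_step_sum normrM (ger0_norm (x := lam^-1)) ?invr_ge0 ?(ltW lam0)//.
have -> : (1 - 2 / lam) * N z + (A + B + L1 + L2) / lam =
    ((lam - 2) * N z + (A + B + L1 + L2)) / lam by field; rewrite gt_eqF.
rewrite ler_pM2r ?invr_gt0//.
have zmin : - N z <= vmax z.1 + vmax z.2.
  apply: le_trans (vmin_linf_oplus z) _.
  by rewrite lerD// vmin_le_vmax.
exact: (growth_arith lam2 zmin (vmax_linf_oplus z) aA bB (L1P _ _ _) (L2P _ _ _)).
Qed.

Lemma lse_step_lip (r : R) : 0 <= r -> exists2 q : R, 0 <= q < 1 &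
  forall z w, N z <= r -> N w <= r ->
    N (lse_step z - lse_step w) <= q * N (z - w).
Proof.
(* In the ball of radius [r], [N (z - w) <= 2 * r], so the components of [w] and [z - w] have
   oscillation at most [4 * r]. *)
move=> r0; have r40 : 0 <= 4 * r by rewrite mulr_ge0.
have [k1 /andP[k10 k11] k1P] :=
  @ln_lse_int_gain _ _ _ mu lam G lam1 mG mu0 Gint _ _ u v meas_u meas_v uG vG _ r40.
have [k2 /andP[k20 k21] k2P] :=
  @ln_lse_int_gain _ _ _ mu lam G lam1 mG mu0 Gint _ _ v u meas_v meas_u vG uG _ r40.
pose k := Num.min k1 k2.
have k0 : 0 < k by rewrite lt_min k10.
have kk1 : k <= k1 by rewrite ge_min lexx.
have kk2 : k <= k2 by rewrite ge_min lexx orbT.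
clearbody k.
have kl0 : 0 < k / lam by rewrite divr_gt0.
have k_le1 : k <= 1 by exact: le_trans kk1 k11.
have kl1 : k / lam <= 1 / 2.
  by rewrite ler_pdivrMr//; move: lam2 => lam_gt2; lra.
exists (1 - 2 * (k / lam)); first by apply/andP; split; lra.
(* A bound on one side suffices: exchanging [z] and [w] gives the other. *)
have half z w i j : N z <= r -> N w <= r ->
    (lse_step z - lse_step w).1 0 i + (lse_step z - lse_step w).2 0 j <=
    (1 - 2 * (k / lam)) * N (z - w).
  move=> zr wr.
  rewrite lse_step_sumB.
  have -> : (1 - 2 * (k / lam)) * N (z - w) = (lam - 2 * k) * N (z - w) / lam.
    by field; rewrite gt_eqF.
  rewrite ler_pM2r ?invr_gt0//.
  have zwr : N (z - w) <= 2 * r.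
    have := linf_oplusD z (- w); rewrite linf_oplusN; lra.
  have [ow1 ow2] := osc_linf_oplus w; have [oz1 oz2] := osc_linf_oplus (z - w).
  have w4 : 2 * N w <= 4 * r by lra.
  have zw4 : 2 * N (z - w) <= 4 * r by lra.
  have g1 := k1P z.1 z.2 w.1 w.2 i (le_trans ow2 w4) (le_trans oz2 zw4).
  have g2 := k2P z.2 z.1 w.2 w.1 j (le_trans ow1 w4) (le_trans oz1 zw4).
  exact: (contraction_arith lam2 k_le1 kk1 kk2 (vmin_le_vmax _)
    (vmin_le_vmax _) (vmax_linf_oplus (z - w)) (vmin_linf_oplus (z - w)) g1 g2).
move=> z w zr wr; apply: linf_oplus_le => i j.
rewrite ler_norml half// andbT lerNl linf_oplusC.
apply: le_trans (half w z i j wr zr).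
by rewrite le_eqVlt; apply/orP; left; apply/eqP; exact: sum_coordBC.
Qed.

(* Both [\sum_i expR (lam * al i) * I z i] and its counterpart for [be] are the
   total mass of [phi * psi], so a shift by [(r, - r)] forces
   [expR (- lam * r) = expR (lam * r)]. *)
Lemma lse_step_fix z : N (lse_step z - z) = 0 -> lse_step z = z.
Proof.
move=> Nz0; pose dz := lse_step z - z.
(* Vanishing of all these sums makes [dz.1] constant, equal to [r], and [dz.2] constant, equal to
   [- r]. *)
have dz0 i j : dz.1 0 i + dz.2 0 j = 0.
  by apply/eqP; rewrite -normr_le0 -Nz0; exact: linf_oplus_ub.
pose r := dz.1 0 ord0.
have d1 i : (lse_step z).1 0 i = z.1 0 i + r.
  have <- : dz.1 0 i = r by apply: (addIr (dz.2 0 ord0)); rewrite !dz0.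
  by rewrite /dz coordB1 [RHS]addrC subrK.
have d2 j : (lse_step z).2 0 j = z.2 0 j - r.
  have <- : dz.2 0 j = - r by apply: (addrI r); rewrite dz0 subrr.
  by rewrite /dz coordB2 [RHS]addrC subrK.
pose S := \int[mu]_z' expR (lse lam (u^~ z') z.1 + lse lam (v^~ z') z.2).
have I0 := @lse_int_gt0 _ _ _ mu lam G lam1 mu0 Gint _ _ u v meas_u meas_v uG vG.
have J0 := @lse_int_gt0 _ _ _ mu lam G lam1 mu0 Gint _ _ v u meas_v meas_u vG uG.
have Sa : expR (- (lam * r)) * (\sum_(i < n.+1) a i) = S.
  rewrite /S -(sum_lse_int lam1 Gint meas_u meas_v uG vG) mulr_sumr.
  apply: eq_bigr => i _.
  rewrite -[a i in LHS]lnK ?posrE// -[I z i]lnK ?posrE// -!expRD; congr expR.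
  have := d1 i; rewrite lse_step1 => d1i.
  have -> : z.1 0 i = 1 / lam * ln (a i) - 1 / lam * ln (I z i) - r by lra.
  by field; rewrite gt_eqF.
have Sb : expR (lam * r) * (\sum_(j < m.+1) b j) = S.
  rewrite /S; under eq_Rintegral do rewrite addrC.
  rewrite -(sum_lse_int lam1 Gint meas_v meas_u vG uG) mulr_sumr.
  apply: eq_bigr => j _.
  rewrite -[b j in LHS]lnK ?posrE// -[J z j]lnK ?posrE// -!expRD; congr expR.
  have := d2 j; rewrite lse_step2 => d2j.
  have -> : z.2 0 j = 1 / lam * ln (b j) - 1 / lam * ln (J z j) + r by lra.
  by field; rewrite gt_eqF.
have b_sum0 : 0 < \sum_(j < m.+1) b j.
  by rewrite big_ord_recl ltr_pwDl// sumr_ge0// => j _; rewrite ltW.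
have r0 : r = 0.
  have : expR (- (lam * r)) = expR (lam * r).
    by apply: (mulIf (lt0r_neq0 b_sum0)); rewrite -[in LHS]ab_sum Sa.
  move/expR_inj => lr; apply: (mulfI (lt0r_neq0 lam0)); lra.
have e1 : (lse_step z).1 = z.1 by apply/rowP => i; rewrite d1 r0 addr0.
have e2 : (lse_step z).2 = z.2 by apply/rowP => j; rewrite d2 r0 subr0.
by rewrite [LHS]surjective_pairing e1 e2 -surjective_pairing.
Qed.

End log_sum_exp_iteration.

(** * Integration against a measure with density *)

Section density.
Context d (T : measurableType d) (R : realType).
Context (mu nu : {measure set T -> \bar R}) (g : T -> R).
Hypotheses (g0 : forall z, 0 <= g z) (mg : measurable_fun setT g).
Hypothesis nuE : forall A, measurable A -> nu A = (\int[mu]_(z in A) (g z)%:E)%E.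

Import HBNNSimple.
Local Open Scope ereal_scope.

(** Monotone convergence along simple functions reduces the claim to indicators, where it is
    [nuE]. *)
Lemma ge0_integral_density (f : T -> \bar R) :
  (forall z, 0 <= f z) -> measurable_fun setT f ->
  \int[nu]_z f z = \int[mu]_z (f z * (g z)%:E).
Proof.
move=> f0 mf; pose h := nnsfun_approx measurableT mf.
have hf z : (h k z)%:E @[k --> \oo] --> f z by exact: cvg_nnsfun_approx.
have ndh z : {homo (fun k => (h k z)%:E) : k l / (k <= l)%N >-> k <= l}.
  by move=> k l kl; rewrite lee_fin; exact/lefP/nd_nnsfun_approx.
have -> : \int[nu]_z f z = limn (fun k => \int[nu]_z (h k z)%:E).
  rewrite -monotone_convergence//.
  - by apply: eq_integral => z _; apply/esym/cvg_lim => //; exact: hf.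
  - by move=> k; apply/measurable_EFinP.
  - by move=> k z _; rewrite lee_fin.
have -> : \int[mu]_z (f z * (g z)%:E) =
    limn (fun k => \int[mu]_z ((h k z)%:E * (g z)%:E)).
  rewrite -monotone_convergence//.
  - apply: eq_integral => z _; apply/esym/cvg_lim => //.
    by apply: cvgeZr => //; exact: hf.
  - by move=> k; apply: emeasurable_funM; apply/measurable_EFinP.
  - by move=> k z _; rewrite mule_ge0// lee_fin.
  - by move=> z _ k l kl; rewrite lee_wpmul2r ?lee_fin// -lee_fin; exact: ndh.
congr (limn _); apply/funext => k.
have hpre y : measurable (h k @^-1` [set y]) by exact: measurable_funPTI.
have mind y : measurable_fun setT (fun z => (y * \1_(h k @^-1` [set y]) z)%:E).
  by apply/measurable_EFinP; exact: measurable_funM.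
have -> : \int[nu]_z (h k z)%:E =
    \sum_(y \in range (h k)) \int[nu]_z (y * \1_(h k @^-1` [set y]) z)%:E.
  under eq_integral do rewrite fimfunE -fsumEFin//.
  by rewrite ge0_integral_fsum// => y z _; exact: nnfun_muleindic_ge0.
have -> : \int[mu]_z ((h k z)%:E * (g z)%:E) = \sum_(y \in range (h k))
    \int[mu]_z ((y * \1_(h k @^-1` [set y]) z)%:E * (g z)%:E).
  under eq_integral => z _.
    rewrite fimfunE -fsumEFin// ge0_mule_fsuml; last first.
      by move=> y; exact: nnfun_muleindic_ge0.
    over.
  rewrite ge0_integral_fsum//.
  - by move=> y; apply: emeasurable_funM => //; exact/measurable_EFinP.
  - move=> y z _; apply: mule_ge0; last by rewrite lee_fin.
    exact: nnfun_muleindic_ge0.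
apply: eq_fsbigr => y /[!inE] -[z0 _ hy].
have y0 : (0 <= y)%R by rewrite -hy.
under eq_integral do rewrite EFinM.
rewrite ge0_integralZl//; last first.
  by apply/measurable_EFinP.
under [RHS]eq_integral do rewrite EFinM -muleA.
rewrite ge0_integralZl//; last 2 first.
- by apply: emeasurable_funM; apply/measurable_EFinP.
- by move=> z _; rewrite mule_ge0// lee_fin.
congr (_ * _); rewrite integral_indic// setIT nuE// integral_mkcond.
apply: eq_integral => z _; rewrite /patch indicE.
by case: ifPn => _; rewrite ?mul1e ?mul0e.
Qed.

End density.

(** * Integrability under the Gaussian weight *)

Section gaussian_integrability.
Context (R : realType) (d : nat).

Lemma measurable_dot (p : euclid R d) :
  measurable_fun [set: euclid R d] (fun x => dot x p).
Proof.
apply: measurable_sum => k; apply: measurable_funM => //.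
exact: measurable_tnth.
Qed.

(** Linear growth is absorbed by the quadratic exponent of the weight: apply
    [s * c <= s ^+ 2 / 2 + c ^+ 2 / 2] in each coordinate. *)
Lemma sum_dot_le_sqnorm n (p : 'I_n -> euclid R d) (C : R) :
  exists K, forall x, C * (\sum_(i < n) `|dot x (p i)|) <= 1 / 2 * dot x x + K.
Proof.
pose c k := `|C| * \sum_(i < n) `|tnth (p i) k|.
exists (\sum_(k < d) c k ^+ 2 / 2) => x.
apply: (@le_trans _ _ (\sum_(k < d) `|tnth x k| * c k)).
  apply: (@le_trans _ _ (`|C| * \sum_(i < n) `|dot x (p i)|)).
    by rewrite ler_wpM2r ?sumr_ge0// ler_norm.
  under [leRHS]eq_bigr do rewrite /c mulrCA mulr_sumr.
  rewrite -mulr_sumr ler_wpM2l// exchange_big/= ler_sum// => i _.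
  apply: le_trans (ler_norm_sum _ _ _) _.
  by apply: ler_sum => k _; rewrite normrM.
rewrite /dot mulr_sumr -big_split/= ler_sum// => k _.
have -> : tnth x k * tnth x k = `|tnth x k| ^+ 2 by rewrite real_normK ?num_real.
have := sqr_ge0 (`|tnth x k| - c k); lra.
Qed.

Variable gamma : probability (euclid R d * euclid R d)%type R.

(** The weight is positive everywhere and [gamma] has mass [1]. *)
Lemma gamma_tilde_neq0 : gamma_tilde gamma setT != 0%E.
Proof.
have mw := @measurable_gauss_weight R d.
have wint : gamma.-integrable setT (EFin \o @gauss_weight R d).
  have i1 := finite_measure_integrable_cst gamma 1 measurableT.
  apply: (le_integrable measurableT _ _ i1); first exact/measurable_EFinP.
  move=> z _ /=; rewrite lee_fin normr1 ger0_norm ?expR_ge0// -expR0 ler_expR.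
  have sq (t : euclid R d) : 0 <= dot t t.
    by apply: sumr_ge0 => k _; rewrite -expr2 sqr_ge0.
  by have := sq z.1; have := sq z.2; lra.
have g1 : gamma setT != 0%E by rewrite probability_setT.
have := Rintegral_gt0 g1 wint (fun z => expR_gt0 _).
apply: contraTneq => h; rewrite -leNgt /Rintegral.
by rewrite (_ : (\int[gamma]_z _)%E = 0%E)// -h.
Qed.

(** Under [gamma] the integrand becomes [expR (G z)] times the weight, at most [expR K], and [gamma]
    is finite. *)
Lemma gamma_tilde_integrable_exp (G : euclid R d * euclid R d -> R) (K : R) :
  measurable_fun setT G ->
  (forall z, G z <= 1 / 2 * dot z.1 z.1 + 1 / 2 * dot z.2 z.2 + K) ->
  (gamma_tilde gamma).-integrable setT (EFin \o (fun z => expR (G z))).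
Proof.
move=> mG GK; have mw := @measurable_gauss_weight R d.
have mexpG : measurable_fun setT (EFin \o (fun z => expR (G z))).
  by apply/measurable_EFinP; exact: measurableT_comp.
apply/integrableP; split => //.
under eq_integral do rewrite /= ger0_norm ?expR_ge0//.
have w0 (z : euclid R d * euclid R d) : 0 <= gauss_weight z.
  exact: expR_ge0.
have expG0 z : (0 <= (EFin \o (fun z => expR (G z))) z)%E.
  by rewrite lee_fin expR_ge0.
rewrite (@ge0_integral_density _ _ _ gamma (gamma_tilde gamma) _ w0 mw (fun _ _ => erefl) _ expG0)//.
apply: (@le_lt_trans _ _ (\int[gamma]_z (expR K)%:E)%E).
  apply: ge0_le_integral => //.
  - by move=> z _; rewrite mule_ge0// lee_fin expR_ge0.
  - by apply: emeasurable_funM => //; exact/measurable_EFinP.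
  - move=> z _; rewrite -EFinM -expRD lee_fin ler_expR.
    by have := GK z; lra.
by rewrite integral_cst// [X in (_ * X)%E]probability_setT mule1 ltry.
Qed.

End gaussian_integrability.

(** * Application to [Psi] *)

Lemma phiE (R : realType) (d n : nat) (lam : R) (p : 'I_n.+1 -> euclid R d) z al :
  phi lam p z al = expR (lse lam (fun i => dot z (p i)) al).
Proof. exact: powR_sumexp. Qed.

Lemma PsiE (R : realType) (d n m : nat) (a : 'I_n.+1 -> R) (b : 'I_m.+1 -> R)
    (x : 'I_n.+1 -> euclid R d) (y : 'I_m.+1 -> euclid R d)
    (gamma : probability (euclid R d * euclid R d)%type R) (lam : R) :
  Psi a b x y gamma lam = lse_step (gamma_tilde gamma) lam
    (fun i z => dot z.1 (x i)) (fun j z => dot z.2 (y j)) a b.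
Proof.
apply/funext => ab; congr pair; apply/rowP => i; rewrite !mxE.
  congr (_ - _ * ln _); apply: eq_Rintegral => z _.
  by rewrite !phiE -expRM -!expRD; congr expR; rewrite /lse_pot; ring.
congr (_ - _ * ln _); apply: eq_Rintegral => z _.
by rewrite !phiE -expRM -!expRD; congr expR; rewrite /lse_pot; ring.
Qed.

Theorem proposition6p1 (R : realType) (d n m : nat)
    (a : 'I_n.+1 -> R) (b : 'I_m.+1 -> R)
    (x : 'I_n.+1 -> euclid R d) (y : 'I_m.+1 -> euclid R d)
    (mu nu : probability (euclid R d) R)
    (mu_def : forall A : set (euclid R d), measurable A ->
       mu A = (\sum_(i < n.+1) (a i)%:E * \d_(x i) A)%E)
    (nu_def : forall A : set (euclid R d), measurable A ->
       nu A = (\sum_(j < m.+1) (b j)%:E * \d_(y j) A)%E)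
    (a_gt0 : forall i, 0 < a i) (b_gt0 : forall j, 0 < b j)
    (a_sum : \sum_(i < n.+1) a i = 1) (b_sum : \sum_(j < m.+1) b j = 1)
    (gamma : probability (euclid R d * euclid R d)%type R)
    (gamma_ac : gamma `<< (lebesgue_euclid R d \x lebesgue_euclid R d)%E)
    (lambda : R) (lambda_gt2 : 2 < lambda) :
  let F := Psi a b x y gamma lambda in
  (exists2 M : R, 0 < M &
     forall r : R, M <= r ->
       contraction_on (@linf_oplus R n m) (@B_oplus R n m r) F) /\
  (exists (theta : R) (ab_lambda : 'rV[R]_n.+1 * 'rV[R]_m.+1),
     [/\ 0 < theta < 1, F ab_lambda = ab_lambda &
       forall ab : 'rV[R]_n.+1 * 'rV[R]_m.+1,
         (fun t : nat => linf_oplus (iter t F ab - ab_lambda)) =O_\oo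
         (fun t : nat => theta ^+ t)]).
Proof.
rewrite PsiE => F.
pose u (i : 'I_n.+1) (z : euclid R d * euclid R d) := dot z.1 (x i).
pose v (j : 'I_m.+1) (z : euclid R d * euclid R d) := dot z.2 (y j).
(* A common majorant of all inner products that still grows only linearly, so every [expR (C * G z)]
   is integrable for [gamma_tilde]. *)
pose G z := \sum_(i < n.+1) `|u i z| + \sum_(j < m.+1) `|v j z|.
have meas_u i : measurable_fun setT (u i).
  exact: (measurableT_comp (measurable_dot (x i)) measurable_fst).
have meas_v j : measurable_fun setT (v j).
  exact: (measurableT_comp (measurable_dot (y j)) measurable_snd).
have mG : measurable_fun setT G.
  by apply: measurable_funD; apply: measurable_sum => k; exact: measurableT_comp.
have uG i z : `|u i z| <= G z.
  by rewrite /G (bigD1 i)//= -addrA lerDl addr_ge0 ?sumr_ge0.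
have vG j z : `|v j z| <= G z.
  by rewrite /G addrC (bigD1 j)//= -addrA lerDl addr_ge0 ?sumr_ge0.
have Gint C : (gamma_tilde gamma).-integrable setT
    (EFin \o (fun z => expR (C * G z))).
  have [K1 K1P] := sum_dot_le_sqnorm x C; have [K2 K2P] := sum_dot_le_sqnorm y C.
  apply: (@gamma_tilde_integrable_exp _ _ _ _ (K1 + K2)).
    exact: measurable_funM.
  by move=> z; have := K1P z.1; have := K2P z.2; rewrite /G /u /v mulrDr; lra.
have G0 := gamma_tilde_neq0 gamma.
have lam0 : 0 < lambda by exact: lt_trans lambda_gt2.
have ab_sum : \sum_(i < n.+1) a i = \sum_(j < m.+1) b j by rewrite a_sum b_sum.
have w01 : 0 <= 1 - 2 / lambda < 1.
  by rewrite subr_ge0 ler_pdivrMr// mul1r (ltW lambda_gt2) gtrBl divr_gt0.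
have [C C0 FC] := lse_step_growth lambda_gt2 mG G0 Gint meas_u meas_v uG vG a b.
have Flip := lse_step_lip lambda_gt2 mG G0 Gint meas_u meas_v uG vG a b.
have Ffix := lse_step_fix lambda_gt2 G0 Gint meas_u meas_v uG vG a_gt0 b_gt0 ab_sum.
split; last exact: quotient_linear_convergence w01 C0 FC Flip Ffix.
(* The stable radius of the abstract contraction result; [+ 1] ensures positivity when [C = 0]. *)
exists (C / (1 - (1 - 2 / lambda)) + 1).
  rewrite ltr_wpDl// divr_ge0//; case/andP: w01 => _; rewrite -subr_gt0.
  exact: ltW.
move=> r Mr; apply: contraction_on_B_oplus w01 C0 FC Flip _ _.
by apply: le_trans Mr; rewrite lerDl.
Qed.
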